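(* Let $(f(n,k))_{2\le k\le n}$ be the family of coefficients in the expansion $$\tau[(P+QPQ)^n]=\tau(P)+\sum_{k=2}^n f(n,k)\,\tau[(PQ)^k],\qquad n\ge 2,$$ for orthogonal projections $P,Q$ in a tracial non-commutative probability space, where $f(n,k)$ is defined by the enumeration of words given in the context. Then this family is characterised by the following identities: (1) $(f(n,n))_{n\ge1}$ is the Lucas sequence: $f(1,1)=1$, $f(2,2)=3$ and, for any $n\ge 3$, $f(n,n)=f(n-1,n-1)+f(n-2,n-2)$. (2) If $k\in\{2,3\}$, then $f(n,k)=n+\delta_{n,k}$ for all $n\ge k$, where $\delta_{n,k}$ is the Kronecker delta. (3) For any $n\ge 4$ and $k\in\{3,\ldots,n-1\}$, $$f(n,k)=f(n-1,k-1)+f(n-1,k)-f(n-2,k-1)+f(n-2,k-2),$$ where $f(n-2,1)=0$ for any $n\ge4$.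
   Context: A tracial non-commutative probability space $(\mathcal{A},\tau)$ is a unital $*$-algebra with a state $\tau$ satisfying $\tau(xy)=\tau(yx)$; an orthogonal projection is an element $P=P^\star=P^2$. Definition of $f(n,k)$: expand $(P+QPQ)^n$ as the sum of the $2^n$ words of length $n$ in the two letters $P$ and $QPQ$, and reduce each word using only the rules $P^2=P$ and $Q^2=Q$. Each reduced word is one of $P$, $(PQ)^k$, $(QP)^k$, $P(QP)^k$, $Q(PQ)^k$ with $k\geq 1$, and for $n\ge2$ only $k\ge 2$ occurs. By traciality, the word $P^n$ reduces to $P$ and contributes $\tau(P)$, and every word reducing to one of $(PQ)^k,(QP)^k,P(QP)^k,Q(PQ)^k$ contributes $\tau[(PQ)^k]$. Then $f(n,k)$ is the number of the $2^n$ words whose reduction is one of $(PQ)^k,(QP)^k,P(QP)^k,Q(PQ)^k$. In particular $f(1,1)=1$ (the word $QPQ=Q(PQ)$). *)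

(* Defs.v *)
From HB Require Import structures.
From mathcomp Require Import all_boot all_order all_algebra.
From mathcomp Require Import reals complex.

Set Implicit Arguments.
Unset Strict Implicit.
Unset Printing Implicit Defensive.

Import Order.TTheory GRing.Theory Num.Theory.
Local Open Scope ring_scope.

Record is_tracial_ncps (R : realType) (A : algType R[i])
    (star : A -> A) (tau : {scalar A}) : Prop := IsTracialNcps {
  starD : forall x y, star (x + y) = star x + star y;
  starZ : forall (c : R[i]) x, star (c *: x) = c^* *: star x;
  starM : forall x y, star (x * y) = star y * star x;
  starK : involutive star;
  tau1 : tau 1 = 1;
  tau_ge0 : forall x, 0 <= tau (star x * x);
  tau_tracial : forall x y, tau (x * y) = tau (y * x) }.

Definition orthogonal_projection (A : pzRingType) (star : A -> A) (p : A) :=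
  star p = p /\ p ^+ 2 = p.

Variant letter := LP | LQ.

Definition bool_of_letter (a : letter) := if a is LP then true else false.
Definition letter_of_bool (b : bool) := if b then LP else LQ.
Lemma bool_of_letterK : cancel bool_of_letter letter_of_bool.
Proof. by case. Qed.
HB.instance Definition _ := Equality.copy letter (can_type bool_of_letterK).

Notation word := (seq letter).

Fixpoint reduce (w : word) : word :=
  if w is a :: w' then
    if w' is b :: _ then if a == b then reduce w' else a :: reduce w'
    else [:: a]
  else [::].

(* [reduce] is invariant under the rules PP -> P and QQ -> Q and fixes the
   irreducible words, so that [reduce w] is the normal form of [w]. *)
Lemma reduce_dup (u v : word) (a : letter) :
  reduce (u ++ [:: a, a & v]) = reduce (u ++ a :: v).
Proof.
elim: u => [|b u IHu] /=; first by rewrite eqxx.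
by case: u IHu => [|c u] /= ->.
Qed.

Lemma reduce_id (w : word) : sorted (fun a b => a != b) w -> reduce w = w.
Proof.
elim: w => [|a [|b w] IHw] // /andP[neq_ab sorted_w].
by rewrite -[in RHS]IHw //= (negPf neq_ab).
Qed.

Definition wpow (w : word) (k : nat) : word := flatten (nseq k w).

(* A word of length n in the two letters P and QPQ is encoded by an n-tuple
   of booleans, [true] standing for QPQ. *)
Definition expand (s : seq bool) : word :=
  flatten [seq if b then [:: LQ; LP; LQ] else [:: LP] | b <- s].

Definition alternating (k : nat) : seq word :=
  [:: wpow [:: LP; LQ] k; wpow [:: LQ; LP] k;
      LP :: wpow [:: LQ; LP] k; LQ :: wpow [:: LP; LQ] k].

Definition f (n k : nat) : nat :=
  #|[set s : n.-tuple bool | reduce (expand s) \in alternating k]|.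

(* Integer values make the subtraction in the recursion a genuine one.  Only
   the entries g n k with 1 <= k <= n are constrained. *)
Record coefficient_identities (g : nat -> nat -> int) : Prop :=
    CoefficientIdentities {
  diag1 : g 1%N 1%N = 1;
  diag2 : g 2%N 2%N = 3;
  diag_rec : forall n : nat, (3 <= n)%N ->
    g n n = g (n - 1)%N (n - 1)%N + g (n - 2)%N (n - 2)%N;
  col23 : forall n k : nat, k \in [:: 2%N; 3%N] -> (k <= n)%N ->
    g n k = n%:Z + (n == k)%:Z;
  col1 : forall n : nat, (4 <= n)%N -> g (n - 2)%N 1%N = 0;
  coef_rec : forall n k : nat, (4 <= n)%N -> (3 <= k <= n - 1)%N ->
    g n k = g (n - 1)%N (k - 1)%N + g (n - 1)%N k
            - g (n - 2)%N (k - 1)%N + g (n - 2)%N (k - 2)%N }.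

(* Main.v *)
Require Import Defs.
From HB Require Import structures.
From mathcomp Require Import all_boot all_order all_algebra.
From mathcomp Require Import reals complex.
From mathcomp Require Import ring zify.

Import Order.TTheory GRing.Theory Num.Theory.
Local Open Scope ring_scope.

(** Normal forms of words for the rules PP -> P and QQ -> Q are the alternating
    words, and such a word is (PQ)^k, (QP)^k, P(QP)^k or Q(PQ)^k with k half
    its length ([sorted_alternating]).  The expansion of (P + QPQ)^n therefore
    sorts its words by that half-length: for every additive trace and every
    pair of idempotents P, Q, and all n >= 1,

      tau ((P + QPQ)^n) = \sum_(k <= n) f(n,k) m_k,

    with m_0 = tau P and m_k = tau ((PQ)^k) for k >= 1 ([trace_expansion]).
    The identity is purely algebraic, so it can be evaluated in any ring with a
    trace, in particular over other scalars than the complex numbers.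

    The combinatorics of f is read off from one generic model: two rank one
    idempotent 2 x 2 matrices over Z[X] with PQP = X P.  There m_k = X^k, so
    the trace of N^n, where N = P + QPQ, is the generating polynomial
    \sum_k f(n,k) X^k ([genpoly_sum]).  Since N has trace 1 + X and
    determinant X (1 - X), the Cayley-Hamilton theorem gives
    N^2 = (1 + X) N - X (1 - X), and the traces T_n of N^n satisfy

      T_(n+2) = (1 + X) T_(n+1) - (X - X^2) T_n.

    Taking coefficients yields the four-term recursion for f; on the diagonal
    two of its terms lie above the degree and it becomes the Lucas recursion.
    An induction on n in each column gives the columns 2 and 3 as well as
    f(n,0) = 1 for n >= 1 and f(n,1) = 0 for n >= 2.  These last two values turn the sum above
    into tau P plus a sum starting at k = 2.

    Uniqueness is a strong induction on n: the diagonal and the columns 2 and 3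
    are prescribed, and for 4 <= k < n every index pair on the right of
    the four-term recursion lies in the triangle 2 <= k <= n ([coefficient_identities_uniq]). *)

(** * Normal forms of words *)

Definition flip (a : letter) : letter := if a is LP then LQ else LP.

Fixpoint altword (a : letter) (m : nat) : word :=
  if m is m'.+1 then a :: altword (flip a) m' else [::].

Lemma size_altword (a : letter) (m : nat) : size (altword a m) = m.
Proof. by elim: m a => //= m IHm a; rewrite IHm. Qed.

Lemma altword_even (a : letter) (k : nat) :
  altword a k.*2 = wpow [:: a; flip a] k.
Proof.
by elim: k => //= k; case: a => /= ->.
Qed.

Lemma sorted_altword (a : letter) (w : word) :
  sorted (fun a b => a != b) (a :: w) -> a :: w = altword a (size w).+1.
Proof.
elim: w a => // b w IHw a /= /andP[neq_ab path_w].
by rewrite (IHw b path_w) /=; case: a b neq_ab {path_w} => [] [].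
Qed.

Lemma reduce_head (a : letter) (w : word) :
  exists w', reduce (a :: w) = a :: w'.
Proof.
elim: w a => [|b w IHw] a; first by exists [::].
rewrite [reduce _]/=; case: eqP => [->|_]; first exact: IHw.
by eexists.
Qed.

Lemma reduce_sorted (w : word) : sorted (fun a b => a != b) (reduce w).
Proof.
elim: w => [|a [|b w] IHw] //; rewrite [reduce _]/=.
case: eqVneq => // neq_ab; have [w' eq_w'] := reduce_head b w.
by rewrite -/(reduce (b :: w)) eq_w' in IHw *; rewrite /= neq_ab.
Qed.

Lemma mem_reduce (w : word) : reduce w =i w.
Proof.
elim: w => [|a [|b w] IHw] // c; rewrite [reduce _]/= -/(reduce (b :: w)).
case: eqVneq => [->|_]; rewrite !in_cons IHw !in_cons //.
by rewrite orbA orbb.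
Qed.

Lemma count_reduce (p : pred letter) (w : word) :
  (count p (reduce w) <= count p w)%N.
Proof.
elim: w => [|a [|b w] IHw] //; rewrite [reduce _]/= -/(reduce (b :: w)).
case: eqP => _; last by rewrite /= leq_add2l.
exact: leq_trans IHw (leq_addl _ _).
Qed.

Lemma count_wpow (p : pred letter) (w : word) (k : nat) :
  count p (wpow w k) = (k * count p w)%N.
Proof. by elim: k => //= k IHk; rewrite count_cat IHk mulSn. Qed.

Lemma count_expand (s : seq bool) : count (pred1 LP) (expand s) = size s.
Proof. by elim: s => //= b s IHs; rewrite count_cat IHs; case: b. Qed.

Lemma size_alternating (w : word) (k : nat) :
  w \in alternating k -> (size w)./2 = k.
Proof.
have size_wpow a b : size (wpow [:: a; b] k) = k.*2.
  by rewrite -count_predT count_wpow -muln2.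
by rewrite !inE => /or4P[] /eqP -> /=; rewrite size_wpow ?uphalf_double ?doubleK.
Qed.

(** Splitting the length as an even part plus a parity, together with the
    choice of the first letter, produces the four families. *)
Lemma sorted_alternating (w : word) :
  sorted (fun a b => a != b) w -> w \in alternating (size w)./2.
Proof.
case: w => [|a w] // sorted_w; rewrite (sorted_altword a w sorted_w) size_altword.
move: (size w).+1 => m; rewrite -{1}(odd_double_half m).
by case: (odd m); rewrite /= ?add0n altword_even; case: a {sorted_w};
  rewrite !inE eqxx ?orbT.
Qed.

(** The four families with parameter k are exactly the normal forms of
    half-length k, so [f] counts words by the half-length of their normal form;
    in particular each word is counted for exactly one k. *)
Lemma alternatingE (w : word) (k : nat) :
  (reduce w \in alternating k) = ((size (reduce w))./2 == k).
Proof.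
apply/idP/eqP => [/size_alternating //|<-].
exact: sorted_alternating (reduce_sorted _).
Qed.

Lemma alternating_count (w : word) (k : nat) :
  w \in alternating k -> (k <= count (pred1 LP) w)%N.
Proof.
by rewrite !inE => /or4P[] /eqP -> /=; rewrite count_wpow /= muln1.
Qed.

(** Both P and QPQ contain a single letter P, reduction never creates letters,
    and every word of the families with parameter k has at least k letters P. *)
Lemma half_reduce_expand_le (s : seq bool) :
  ((size (reduce (expand s)))./2 <= size s)%N.
Proof.
rewrite -(count_expand s); apply: leq_trans (count_reduce _ _).
exact/alternating_count/sorted_alternating/reduce_sorted.
Qed.

(** * Evaluation in a ring with a trace *)

Definition eval {A : pzSemiRingType} (P Q : A) (w : word) : A :=
  \prod_(a <- w) (if a is LP then P else Q).

Lemma eval_wpow (A : pzSemiRingType) (P Q : A) (w : word) (k : nat) :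
  eval P Q (wpow w k) = eval P Q w ^+ k.
Proof.
elim: k => [|k IHk]; first by rewrite /eval big_nil.
by rewrite exprS -IHk /eval big_cat.
Qed.

Lemma eval_reduce (A : pzSemiRingType) (P Q : A) (w : word) :
  P * P = P -> Q * Q = Q -> eval P Q (reduce w) = eval P Q w.
Proof.
move=> PP QQ; elim: w => [|a [|b w] IHw] //.
rewrite [reduce _]/= -/(reduce (b :: w)) [RHS]/eval big_cons -/(eval _ _ _) -IHw.
case: eqVneq => [->|_]; last by rewrite [LHS]/eval big_cons.
have [w' ->] := reduce_head b w.
by rewrite /eval !big_cons mulrA; case: b {IHw}; rewrite ?PP ?QQ.
Qed.

Lemma eval_expand (A : pzSemiRingType) (P Q : A) (s : seq bool) :
  eval P Q (expand s) = \prod_(b <- s) (if b then Q * P * Q else P).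
Proof.
rewrite /eval big_flatten big_map; apply: eq_bigr => -[] _ /=;
  by rewrite !big_cons big_nil /= ?mulr1 ?mulrA.
Qed.

Lemma exprD_words (A : pzSemiRingType) (x y : A) (n : nat) :
  (x + y) ^+ n = \sum_(s : n.-tuple bool) \prod_(b <- s) (if b then y else x).
Proof.
elim: n => [|n IHn].
  rewrite (big_pred1 [tuple]) ?big_nil // => s.
  by rewrite [s]tuple0 /= eqxx.
rewrite (reindex (fun bs : bool * n.-tuple bool => [tuple of bs.1 :: bs.2])) /=.
  rewrite -(pair_bigA _ (fun b (s : n.-tuple bool) =>
    \prod_(c <- b :: s) (if c then y else x))) big_bool /= exprS mulrDl addrC IHn.
  by congr (_ + _); rewrite mulr_sumr; apply: eq_bigr => s _; rewrite big_cons.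
exists (fun s => (thead s, [tuple of behead s])) => [[b s] _|s _] /=.
  by congr (_, _); apply/val_inj.
by rewrite -tuple_eta.
Qed.

Section Trace.
Context {A : pzSemiRingType} {V : nmodType} (tau : {additive A -> V}).
Hypothesis tauC : forall x y, tau (x * y) = tau (y * x).

Variables P Q : A.
Hypotheses (PP : P * P = P) (QQ : Q * Q = Q).

(** Cyclicity moves the last letter to the front, where idempotence absorbs it
    into (PQ)^k or (QP)^k; the latter two are cyclic rotations of each other. *)
Lemma trace_alternating (w : word) (k : nat) :
  (0 < k)%N -> w \in alternating k -> tau (eval P Q w) = tau ((P * Q) ^+ k).
Proof.
have evalC a (v : word) : eval P Q (a :: v) = (if a is LP then P else Q) * eval P Q v.
  by rewrite /eval big_cons.
have tauQP j : tau ((Q * P) ^+ j.+1) = tau ((P * Q) ^+ j.+1).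
  have shift i : (Q * P) ^+ i * Q = Q * (P * Q) ^+ i.
    elim: i => [|i IHi]; first by rewrite mulr1 mul1r.
    by rewrite exprS -mulrA IHi exprS !mulrA.
  by rewrite exprSr mulrA shift tauC mulrA -exprS.
case: k => // k _; rewrite !inE => /or4P[] /eqP ->.
- by rewrite eval_wpow !evalC /eval big_nil mulr1.
- by rewrite eval_wpow !evalC /eval big_nil mulr1 tauQP.
- rewrite evalC eval_wpow !evalC /eval big_nil mulr1.
  by rewrite tauC exprSr -!mulrA PP -exprSr tauQP.
- rewrite evalC eval_wpow !evalC /eval big_nil mulr1.
  by rewrite tauC exprSr -!mulrA QQ -exprSr.
Qed.

(** The value at 0 is tau P and not the trace of the empty product: half-length
    0 is reached only by the normal form P. *)
Definition moment (k : nat) : V :=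
  if k is 0 then tau P else tau ((P * Q) ^+ k).

(** The family with parameter 0 also contains the empty word and Q; these are
    excluded because a nonempty product of letters P and QPQ keeps a letter P
    in its normal form. *)
Lemma trace_expand (s : seq bool) :
  (0 < size s)%N ->
  tau (eval P Q (expand s)) = moment (size (reduce (expand s)))./2.
Proof.
move=> s_gt0; rewrite -eval_reduce //.
have P_in : LP \in reduce (expand s).
  by rewrite mem_reduce -has_pred1 has_count count_expand.
have := sorted_alternating _ (reduce_sorted (expand s)).
case def_k: (_./2) => [|k] in_alt; last exact: trace_alternating in_alt.
move: in_alt P_in; rewrite !inE.
case/or4P=> /eqP -> //= _.
by rewrite /eval big_seq1.
Qed.

(** Fibring the words over the half-length of their normal form. *)
Lemma trace_expansion (n : nat) : (0 < n)%N ->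
  tau ((P + Q * P * Q) ^+ n) = \sum_(k < n.+1) moment k *+ f n k.
Proof.
move=> n_gt0; rewrite exprD_words raddf_sum.
pose kof (s : n.-tuple bool) : 'I_n.+1 := inord (size (reduce (expand s)))./2.
have kofE s : kof s = (size (reduce (expand s)))./2 :> nat.
  by rewrite inordK // ltnS -[X in (_ <= X)%N](size_tuple s) half_reduce_expand_le.
rewrite (partition_big kof xpredT) //=; apply: eq_bigr => k _.
rewrite -sumr_const; apply: eq_big => [s|s /eqP <-].
  by rewrite inE alternatingE -kofE.
by rewrite -eval_expand trace_expand ?size_tuple // kofE.
Qed.

End Trace.

(** * The generic two-by-two model *)

(** Two rank one idempotents, made generic by the parameter X: compressing either
    of them by the other multiplies by X.  Orthogonal projections would need the
    entry sqrt (X (1 - X)); a non-symmetric matQ keeps the entries polynomial. *)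
Definition matP : 'M[{poly int}]_2 := \matrix_(i, j) ((i == 0) && (j == 0))%:R.
Definition matQ : 'M[{poly int}]_2 := \matrix_(i, j) (if j == 0 then 'X else 1 - 'X).
Definition genpoly (n : nat) : {poly int} := \tr ((matP + matQ * matP * matQ) ^+ n).

Ltac matrix2_ring := apply/matrixP => -[[|[|//]] ?] [[|[|//]] ?];
  rewrite !(mxE, big_ord_recl, big_ord0) /=; ring.

Lemma matPP : matP * matP = matP.
Proof. matrix2_ring. Qed.

Lemma matQQ : matQ * matQ = matQ.
Proof. matrix2_ring. Qed.

Lemma matPQP : matP * matQ * matP = 'X *: matP.
Proof. matrix2_ring. Qed.

Lemma matQPQ : matQ * matP * matQ = 'X *: matQ.
Proof. matrix2_ring. Qed.

(** Cayley-Hamilton for a matrix of trace 1 + X and determinant X (1 - X). *)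
Lemma mat_sum_sqr : let N := matP + matQ * matP * matQ in
  N * N = (1 + 'X) *: N - ('X * (1 - 'X)) *: 1.
Proof. rewrite /= matQPQ; matrix2_ring. Qed.

Lemma moment_mat k : moment mxtrace matP matQ k = 'X^k.
Proof.
have trE (B : 'M[{poly int}]_2) : \tr B = B 0 0 + B 1 1.
  by rewrite /mxtrace !big_ord_recl big_ord0 addr0; congr (_ + B _ _); apply/val_inj.
case: k => [|k] /=; first by rewrite trE !mxE /= addr0.
have -> : (matP * matQ) ^+ k.+1 = 'X^k *: (matP * matQ).
  elim: k => [|k IHk]; first by rewrite scale1r.
  rewrite exprSr IHk -scalerAl mulrA matPQP -scalerAl scalerA; congr (_ *: _).
  by rewrite -exprSr.
rewrite linearZ /= trE !(mxE, big_ord_recl, big_ord0) /= exprS; ring.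
Qed.

(** The moments of the model are the monomials, hence linearly independent:
    its trace expansion determines all the numbers [f n k].  For n = 0 the
    formula fails, as the identity matrix has trace 2. *)
Lemma genpoly_sum (n : nat) :
  (0 < n)%N -> genpoly n = \poly_(k < n.+1) (f n k)%:Z.
Proof.
move=> n_gt0; rewrite /genpoly (trace_expansion mxtrace (fun x y => mxtrace_mulC x y)) //.
- rewrite poly_def; apply: eq_bigr => k _.
  by rewrite moment_mat -scaler_nat natz.
- exact: matPP.
- exact: matQQ.
Qed.

Lemma coef_genpoly (n k : nat) : (0 < n)%N ->
  (genpoly n)`_k = if (k <= n)%N then (f n k)%:Z else 0.
Proof. by move=> n_gt0; rewrite genpoly_sum // coef_poly ltnS. Qed.

Lemma genpoly0 : genpoly 0 = 2.
Proof. by rewrite /genpoly expr0 mxtrace1. Qed.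

Lemma genpoly1 : genpoly 1 = 1 + 'X.
Proof.
rewrite /genpoly expr1 matQPQ mxtraceD mxtraceZ.
rewrite /mxtrace !(mxE, big_ord_recl, big_ord0) /=; ring.
Qed.

Lemma genpoly_rec (n : nat) :
  genpoly n.+2 = genpoly n.+1 + 'X * (genpoly n.+1 - genpoly n + 'X * genpoly n).
Proof.
rewrite /genpoly; set N := matP + _.
have -> : N ^+ n.+2 = (1 + 'X) *: N ^+ n.+1 - ('X * (1 - 'X)) *: N ^+ n.
  by rewrite !exprS mulrA mat_sum_sqr -/N mulrBl -!scalerAl mul1r.
rewrite linearB /= !mxtraceZ; ring.
Qed.

Lemma coef_genpoly_rec (n k : nat) :
  (genpoly n.+2)`_k.+2 = (genpoly n.+1)`_k.+2 + (genpoly n.+1)`_k.+1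
                         - (genpoly n)`_k.+1 + (genpoly n)`_k.
Proof. by rewrite genpoly_rec !(coefD, coefN, coefXM) /= !addrA. Qed.

Lemma coef0_genpoly (n : nat) : (genpoly n.+1)`_0 = 1.
Proof.
elim: n => [|n IHn]; first by rewrite genpoly1 !coefE.
by rewrite genpoly_rec coefD coefXM IHn.
Qed.

Lemma coef1_genpoly (n : nat) : (genpoly n.+2)`_1 = 0.
Proof.
elim: n => [|n IHn]; rewrite genpoly_rec !(coefD, coefN, coefXM) /=.
  by rewrite genpoly1 genpoly0 !coefE.
by rewrite IHn !coef0_genpoly.
Qed.

Lemma coef2_genpoly (n : nat) : (genpoly n.+3)`_2 = n.+3%:Z.
Proof.
elim: n => [|n IHn]; rewrite coef_genpoly_rec coef1_genpoly.
  by rewrite coef_genpoly_rec genpoly1 genpoly0 !coefE.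
by rewrite IHn coef1_genpoly coef0_genpoly; lia.
Qed.

Lemma coef3_genpoly (n : nat) : (genpoly n.+4)`_3 = n.+4%:Z.
Proof.
elim: n => [|n IHn]; rewrite coef_genpoly_rec coef2_genpoly coef1_genpoly.
  by rewrite !coef_genpoly_rec genpoly1 genpoly0 !coefE.
by rewrite IHn coef2_genpoly; lia.
Qed.

Lemma f_col1 (n : nat) : (2 <= n)%N -> f n 1 = 0%N.
Proof.
case: n => [|[|n]] // _; have := coef_genpoly n.+2 1 isT.
by rewrite coef1_genpoly /= => -[].
Qed.

(** * The coefficient identities *)

Lemma coefficient_identities_f :
  coefficient_identities (fun n k : nat => (f n k)%:Z).
Proof.
have fE n k : (0 < n)%N -> (k <= n)%N -> (f n k)%:Z = (genpoly n)`_k.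
  by move=> n_gt0 le_kn; rewrite coef_genpoly ?le_kn.
(* Makes the entries of the recursion above the diagonal vanish. *)
have genpoly_gt n k : (0 < n)%N -> (n < k)%N -> (genpoly n)`_k = 0.
  by move=> n_gt0 lt_nk; rewrite coef_genpoly // leqNgt lt_nk.
split.
- by rewrite fE // genpoly1 !coefE.
- by rewrite fE // coef_genpoly_rec genpoly1 genpoly0 !coefE.
- case=> [|[|[|n]]] // _; rewrite !subSS !subn0 !fE // coef_genpoly_rec.
  by rewrite (genpoly_gt n.+2 n.+3) // (genpoly_gt n.+1 n.+2) // add0r subr0.
- move=> n k k23 le_kn.
  have n_gt0 : (0 < n)%N by apply: leq_trans le_kn; case: k k23.
  rewrite fE //; move: k23 le_kn {n_gt0}; rewrite !inE => /orP[] /eqP ->.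
    case: n => [|[|[|n]]] // _; last by rewrite coef2_genpoly addr0.
    by rewrite coef_genpoly_rec genpoly1 genpoly0 !coefE.
  case: n => [|[|[|[|n]]]] // _; last by rewrite coef3_genpoly addr0.
  by rewrite !coef_genpoly_rec genpoly1 genpoly0 !coefE.
- by move=> n n_ge4; rewrite f_col1 //; lia.
- case=> [|[|[|n]]] // [|[|k]] // _ /andP[_]; rewrite !subSS !subn0 => lt_kn.
  rewrite !fE ?coef_genpoly_rec //; lia.
Qed.

(** For 4 <= k < n the recursion only refers to rows n - 1 and n - 2 and to
    columns between 2 and the row index, so the induction stays inside the
    triangle 2 <= k <= n. *)
Lemma coefficient_identities_uniq (g h : nat -> nat -> int) :
  coefficient_identities g -> coefficient_identities h ->
  forall n k : nat, (2 <= k <= n)%N -> g n k = h n k.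
Proof.
move=> [g11 g22 gD g23 _ gR] [h11 h22 hD h23 _ hR].
have diag n : (0 < n)%N -> g n n = h n n.
  elim/ltn_ind: n => -[|[|[|n]]] // IHn _; rewrite ?g11 ?g22 ?h11 ?h22 //.
  by rewrite gD // hD // !subSS !subn0 !IHn.
elim/ltn_ind=> n IHn k /andP[k_ge2 le_kn].
have [k23|kN23] := boolP (k \in [:: 2; 3]%N); first by rewrite g23 // h23.
move: le_kn; rewrite leq_eqVlt => /predU1P[eq_kn|lt_kn].
  by rewrite eq_kn diag //; lia.
have k_ge4 : (4 <= k)%N by move: kN23; rewrite !inE; lia.
have n_ge4 : (4 <= n)%N by exact: leq_trans k_ge4 (ltnW lt_kn).
have k_range : (3 <= k <= n - 1)%N by clear -k_ge4 lt_kn; lia.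
rewrite (gR n k n_ge4 k_range) (hR n k n_ge4 k_range).
by rewrite !IHn //; clear -k_ge4 lt_kn; lia.
Qed.

Theorem theorem3 (R : realType) :
  [/\ forall (A : algType R[i]) (star : A -> A) (tau : {scalar A}),
        is_tracial_ncps star tau ->
        forall P Q : A,
          orthogonal_projection star P -> orthogonal_projection star Q ->
        forall n : nat, (2 <= n)%N ->
          tau ((P + Q * P * Q) ^+ n)
          = tau P + \sum_(2 <= k < n.+1) (f n k)%:R * tau ((P * Q) ^+ k),
      coefficient_identities (fun n k : nat => (f n k)%:Z)
    & forall g : nat -> nat -> int, coefficient_identities g ->
        forall n k : nat, (2 <= k <= n)%N -> g n k = (f n k)%:Z].
Proof.
split; last 2 first.
- exact: coefficient_identities_f.
- move=> g g_id; apply: coefficient_identities_uniq g_id _.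
  exact: coefficient_identities_f.
move=> A star tau tau_tr P Q [_ PP] [_ QQ] n n_ge2.
have n_gt0 : (0 < n)%N by apply: ltnW.
have f_n0 : f n 0 = 1%N.
  by have := coef_genpoly n 0 n_gt0; rewrite -(prednK n_gt0) coef0_genpoly => -[].
rewrite (trace_expansion tau (tau_tracial tau_tr)) -?expr2 //.
rewrite -(big_mkord xpredT (fun k => moment tau P Q k *+ f n k)).
rewrite big_ltn // f_n0 big_ltn ?f_col1 // mulr0n add0r; congr (_ + _).
rewrite big_nat [RHS]big_nat; apply: eq_bigr => -[|k] // _.
by rewrite mulr_natl.
Qed.
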